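(* Let $a,b>0$, let $X^*=(x^*,y^* )$ be an equilibrium of the H\'enon system $x_{n+1}=y_n+1-ax_n^2$, $y_{n+1}=bx_n$, and let $0<R<|x^*|$. Let $\alpha_*,\beta_*\in[0,1)$ be convergence bounds for the deterministic controlled H\'enon system on $B_R(X^* )$ (as defined in the context). Let $\chi_i=(\chi_{i,n})_{n\in\mathbb N}$, $i=1,2$, be two sequences of random variables on a probability space $(\Omega,\mathcal F,\mathbb P)$ such that all $\chi_{i,n}$ are mutually independent, for each $i$ the $\chi_{i,n}$, $n\in\mathbb N$, are identically distributed, and $|\chi_{i,n}|\le1$. Let $$d_{i,n}=\alpha_i+\ell_i\chi_{i,n},\qquad i=1,2,\ n\in\mathbb N,\qquad \ell_i\ge 0,$$ and let $X=(x_n,y_n)_{n\in\mathbb N_0}$ be a solution of $$x_{n+1}=d_{1,n+1}x^*+(1-d_{1,n+1})(y_n+1-ax_n^2),\qquad y_{n+1}=d_{2,n+1}y^*+(1-d_{2,n+1})bx_n.$$ Then, for any $\alpha_1\in(\alpha_*,1)$, $\alpha_2\in(\beta_*,1)$, $\ell_1<\min\{\alpha_1-\alpha_*,1-\alpha_1\}$ and $\ell_2<\min\{\alpha_2-\beta_*,1-\alpha_2\}$, $X$ converges to $(x^*,y^* )$ (on $\Omega$) for any initial value $(x_0,y_0)\in B_R(X^* )$.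
   Context: $\mathbb N_0=\{0\}\cup\mathbb N$; $\|\cdot\|$ is a fixed norm on $\mathbb R^2$ and $B_R(X^* )=\{X\in\mathbb R^2:\|X-X^*\|<R\}$. The equilibria of the H\'enon system are $(x^*,y^* )=\left(\frac{1}{2a}\left[b-1\pm\sqrt{4a+(b-1)^2}\right],\,bx^*\right)$. Convergence bounds: constants $\alpha_*,\beta_*\in[0,1)$, depending on $R$, such that for any (deterministic) sequences $a_n\in(\alpha_*,1)$, $b_n\in(\beta_*,1)$, $n\in\mathbb N_0$, and any $(x_0,y_0)\in B_R(X^* )$, the solution of $x_{n+1}=a_nx^*+(1-a_n)(y_n+1-ax_n^2)$, $y_{n+1}=b_ny^*+(1-b_n)bx_n$ converges to $(x^*,y^* )$. (Such constants exist.) *)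

(* Defs.v *)
From mathcomp Require Import all_boot all_order all_algebra.
From mathcomp Require Import finmap.
From mathcomp Require Import all_classical all_reals all_analysis.
From mathcomp Require Import ring lra.

Set Implicit Arguments.
Unset Strict Implicit.
Unset Printing Implicit Defensive.

Import Order.TTheory GRing.Theory Num.Theory.
Import numFieldNormedType.Exports.

Local Open Scope classical_set_scope.
Local Open Scope ring_scope.

Section Henon.
Variable R : realType.
Implicit Types (a b r : R) (nrm : R * R -> R) (X Xs : R * R).

(* Nonnegativity of the norm follows from these three properties. *)
Definition is_norm nrm : Prop :=
  [/\ forall X, nrm X = 0 -> X = 0,
      forall (c : R) X, nrm (c *: (X : R^o * R^o)%type) = `|c| * nrm X
    & forall X Y, nrm (X + Y) <= nrm X + nrm Y].

Definition norm_ball nrm Xs r : set (R * R) := [set X | nrm (X - Xs) < r].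

Definition henon a b X : R * R := (X.2 + 1 - a * X.1 ^+ 2, b * X.1).

Definition henon_equilibrium a b Xs : Prop := henon a b Xs = Xs.

Lemma henon_equilibriumE a b Xs : 0 < a ->
  let D := Num.sqrt (4 * a + (b - 1) ^+ 2) in
  henon_equilibrium a b Xs <->
  (Xs.1 = (2 * a)^-1 * (b - 1 + D) \/ Xs.1 = (2 * a)^-1 * (b - 1 - D)) /\
  Xs.2 = b * Xs.1.
Proof.
move=> a0 D.
have D2 : D ^+ 2 = 4 * a + (b - 1) ^+ 2.
  by rewrite sqr_sqrtr // addr_ge0 ?sqr_ge0 // mulr_ge0 // ltW.
have a2 : 2 * a != 0 by rewrite mulf_neq0 ?pnatr_eq0 // gt_eqF.
case: Xs => x y; rewrite /henon_equilibrium /henon /=.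
have rootE s : (x = (2 * a)^-1 * s) <-> 2 * a * x - s = 0.
  split=> [->|/eqP]; first by rewrite mulrA mulfV // mul1r subrr.
  by rewrite subr_eq0 => /eqP <-; rewrite mulrA mulVf // mul1r.
have fact : (2 * a * x - (b - 1 + D)) * (2 * a * x - (b - 1 - D)) =
    4 * a * (a * x ^+ 2 - (b - 1) * x - 1).
  have -> : (2 * a * x - (b - 1 + D)) * (2 * a * x - (b - 1 - D)) =
    (2 * a * x - (b - 1)) ^+ 2 - D ^+ 2 by ring.
  by rewrite D2; ring.
split=> [[ex ey]|[ex ey]].
  split; last by rewrite ey.
  have : (2 * a * x - (b - 1 + D)) * (2 * a * x - (b - 1 - D)) = 0.
    rewrite fact; suff -> : a * x ^+ 2 - (b - 1) * x - 1 = 0 by rewrite mulr0.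
    by rewrite -{}ey in ex; lra.
  by move/eqP; rewrite mulf_eq0 => /orP[]/eqP e; [left|right]; apply/rootE.
rewrite ey; congr pair.
have : 4 * a * (a * x ^+ 2 - (b - 1) * x - 1) = 0.
  by rewrite -fact; case: ex => /rootE ->; rewrite ?mul0r ?mulr0.
move/eqP; rewrite mulf_eq0 => /orP[|/eqP e]; last by lra.
by rewrite mulf_eq0 pnatr_eq0 /= gt_eqF.
Qed.

Definition controlled_henon a b Xs (c1 c2 : R) X : R * R :=
  (c1 * Xs.1 + (1 - c1) * (X.2 + 1 - a * X.1 ^+ 2),
   c2 * Xs.2 + (1 - c2) * (b * X.1)).

Definition controlled_henon_solution a b Xs (c1 c2 : nat -> R)
    (X : nat -> R * R) : Prop :=
  forall n, X n.+1 = controlled_henon a b Xs (c1 n) (c2 n) (X n).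

Definition convergence_bounds nrm a b Xs r (alphas betas : R) : Prop :=
  [/\ 0 <= alphas < 1, 0 <= betas < 1 &
      forall (an bn : nat -> R) (X : nat -> R * R),
        (forall n, alphas < an n < 1) -> (forall n, betas < bn n < 1) ->
        norm_ball nrm Xs r (X 0%N) ->
        controlled_henon_solution a b Xs an bn X ->
        X n @[n --> \oo] --> Xs].

End Henon.

Section Probability.
Context {d : measure_display} {Omega : measurableType d} {R : realType}.
Variable P : probability Omega R.

Definition mutually_independent (I : choiceType) (D : set I)
    (Y : I -> {RV P >-> R}) : Prop :=
  forall (J : {fset I}) (A : I -> set R),
    [set` J] `<=` D -> (forall i, measurable (A i)) ->
    P (\bigcap_(i in [set` J]) (Y i @^-1` A i)) =
    (\prod_(i <- J) P (Y i @^-1` A i))%E.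

Definition identically_distributed (I : Type) (D : set I)
    (Y : I -> {RV P >-> R}) : Prop :=
  forall i j, D i -> D j ->
  forall A : set R, measurable A -> distribution P (Y i) A = distribution P (Y j) A.

End Probability.

(* Main.v *)
Require Import Defs.
From mathcomp Require Import all_boot all_order all_algebra.
From mathcomp Require Import finmap.
From mathcomp Require Import all_classical all_reals all_analysis.
From mathcomp Require Import lra.
Import Order.TTheory GRing.Theory Num.Theory.
Import numFieldNormedType.Exports.
Local Open Scope classical_set_scope.
Local Open Scope ring_scope.

(** Randomness plays its part one sample point at a time.  For fixed [w] the
noisy controls are ordinary sequences, and the bounds on the amplitudes [ell]
keep every control in the window below 1 in which the deterministic bounds
guarantee convergence ([noisy_control_window]).  Each path is therefore a
deterministic controlled solution starting in the ball, and it converges for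
every [w], with no exceptional null set. *)

Lemma noisy_control_window (R : realDomainType) (lo m l c : R) :
  0 <= l -> l < Num.min (m - lo) (1 - m) -> `|c| <= 1 -> lo < m + l * c < 1.
Proof.
move=> l0; rewrite lt_min => /andP[llo lhi] c1.
have : `|l * c| <= l by rewrite normrM (ger0_norm l0) ler_piMr.
rewrite ler_norml => /andP[lc1 lc2].
by apply/andP; split; lra.
Qed.

Theorem proposition3p4 (R : realType)
  (nrm : R * R -> R) (hnrm : is_norm nrm)
  (a b : R) (ha : 0 < a) (hb : 0 < b)
  (Xs : R * R) (hXs : henon_equilibrium a b Xs)
  (r : R) (hr : 0 < r < `|Xs.1|)
  (alphas betas : R)
  (hbounds : convergence_bounds nrm a b Xs r alphas betas)
  (d : measure_display) (Omega : measurableType d) (P : probability Omega R)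
  (chi : 'I_2 -> nat -> {RV P >-> R})
  (hindep : mutually_independent [set k : 'I_2 * nat | (0 < k.2)%N]
              (fun k => chi k.1 k.2))
  (hid : forall i : 'I_2, identically_distributed [set n | (0 < n)%N] (chi i))
  (hchi : forall (i : 'I_2) (n : nat) (w : Omega),
      (0 < n)%N -> `|chi i n w| <= 1)
  (alpha ell : 'I_2 -> R) (hell : forall i, 0 <= ell i)
  (halpha1 : alphas < alpha 0 < 1) (halpha2 : betas < alpha 1 < 1)
  (hell1 : ell 0 < Num.min (alpha 0 - alphas) (1 - alpha 0))
  (hell2 : ell 1 < Num.min (alpha 1 - betas) (1 - alpha 1))
  (X0 : R * R) (hX0 : norm_ball nrm Xs r X0)
  (X : nat -> Omega -> R * R) (hinit : forall w, X 0%N w = X0)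
  (hsol : forall w : Omega,
      let dn (i : 'I_2) (n : nat) := alpha i + ell i * chi i n w in
      controlled_henon_solution a b Xs
        (fun n => dn 0 n.+1) (fun n => dn 1 n.+1) (fun n => X n w)) :
  forall w : Omega, X n w @[n --> \oo] --> Xs.
Proof.
move=> w; case: hbounds => _ _; apply; last exact: hsol.
- by move=> n; apply: noisy_control_window => //; exact: hchi.
- by move=> n; apply: noisy_control_window => //; exact: hchi.
- by rewrite hinit.
Qed.
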